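(* Suppose $\Gamma$ is a finite graph, with extension graph $\Gamma^e$. (1) If $\Gamma$ is triangle-free, then so is $\Gamma^e$. (2) If $\Gamma$ is square-free, then so is $\Gamma^e$. (3) Suppose $n\ge 5$, and $\Gamma$ is triangle-free or square-free. If $\Gamma$ is $C_m$-free for every $m=5,\ldots,n$, then so is $\Gamma^e$ (i.e. $\Gamma^e$ is $C_m$-free for every $m=5,\ldots,n$). (4) If $\Gamma$ is weakly chordal, then so is $\Gamma^e$. (5) If $\Gamma$ is bipartite, then so is $\Gamma^e$.
   Context: A graph is a (possibly infinite) simplicial 1-complex (no loops, no multi-edges). For a graph $\Gamma$ with vertex set $V(\Gamma)$ and edge set $E(\Gamma)$, the right-angled Artin group is $A(\Gamma)=\langle V(\Gamma)\mid [v,v']=1 \text{ for each } \{v,v'\}\in E(\Gamma)\rangle$. The extension graph $\Gamma^e$ is the graph whose vertices are the elements of $A(\Gamma)$ that are conjugate to vertices of $\Gamma$ (viewed as generators), two distinct vertices being adjacent if and only if they commute in $A(\Gamma)$. $C_n$ is the cycle of length $n$; $C_3$ is a triangle and $C_4$ is a square. A graph is $\Lambda$-free if it contains no induced subgraph isomorphic to $\Lambda$. $X^{\mathrm{opp}}$ denotes the complement graph of $X$. A graph is weakly chordal if it contains no induced $C_n$ and no induced $C_n^{\mathrm{opp}}$ for $n\ge 5$. *)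

(* Defs.v *)
From HB Require Import structures.
From mathcomp Require Import all_boot generic_quotient.
From mathcomp Require Import boolp classical_sets cardinality.

Set Implicit Arguments.
Unset Strict Implicit.
Unset Printing Implicit Defensive.

Local Open Scope group_scope.
Local Open Scope quotient_scope.
Local Open Scope classical_set_scope.

(* The letter (x, true) stands for the generator x and (x, false) for its
   formal inverse; a relator r in R imposes r = 1. *)
Definition word (X : Type) := seq (X * bool).

Definition word_inv (X : Type) (w : word X) : word X :=
  rev [seq (l.1, ~~ l.2) | l <- w].

Inductive pres_eq (X : Type) (R : set (word X)) : word X -> word X -> Prop :=
| pres_refl w : pres_eq R w w
| pres_sym w1 w2 : pres_eq R w1 w2 -> pres_eq R w2 w1
| pres_trans w1 w2 w3 : pres_eq R w1 w2 -> pres_eq R w2 w3 -> pres_eq R w1 w3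
| pres_cat w1 w1' w2 w2' : pres_eq R w1 w1' -> pres_eq R w2 w2' ->
    pres_eq R (w1 ++ w2) (w1' ++ w2')
| pres_cancel x b : pres_eq R [:: (x, b); (x, ~~ b)] [::]
| pres_relator r : R r -> pres_eq R r [::].

Section Presentation.
Variables (X : choiceType) (R : set (word X)).

Definition pres_eqb : rel (word X) := fun w1 w2 => `[< pres_eq R w1 w2 >].

Lemma pres_eqb_refl : reflexive pres_eqb.
Proof. by move=> w; apply/asboolP/pres_refl. Qed.

Lemma pres_eqb_sym : symmetric pres_eqb.
Proof. by move=> w1 w2; apply/asboolP/asboolP; apply: pres_sym. Qed.

Lemma pres_eqb_trans : transitive pres_eqb.
Proof.
by move=> w2 w1 w3 /asboolP h12 /asboolP h23; apply/asboolP/(pres_trans h12).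
Qed.

Canonical pres_equiv := EquivRel pres_eqb
  pres_eqb_refl pres_eqb_sym pres_eqb_trans.

Definition presented := {eq_quot pres_equiv}.

HB.instance Definition _ := EqQuotient.on presented.
HB.instance Definition _ := Choice.on presented.

Definition pres_class (w : word X) : presented := \pi_presented w.

Lemma pres_classP w1 w2 : pres_class w1 = pres_class w2 <-> pres_eq R w1 w2.
Proof.
split=> [/eqmodP /asboolP //|h].
by apply/eqmodP/asboolP.
Qed.

Definition pres_mul (a b : presented) := pres_class (repr a ++ repr b).
Definition pres_one : presented := pres_class [::].
Definition pres_inv (a : presented) := pres_class (word_inv (repr a)).

Lemma pres_repr w : pres_eq R (repr (pres_class w)) w.
Proof. by apply/pres_classP; rewrite /pres_class reprK. Qed.

Lemma pres_classM w1 w2 :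
  pres_mul (pres_class w1) (pres_class w2) = pres_class (w1 ++ w2).
Proof. by apply/pres_classP/pres_cat; apply: pres_repr. Qed.

Lemma pres_class_ind (P : presented -> Prop) :
  (forall w, P (pres_class w)) -> forall a, P a.
Proof. by move=> h a; rewrite -[a]reprK; apply: h. Qed.

Lemma word_invK : involutive (@word_inv X).
Proof.
move=> w; rewrite /word_inv map_rev revK -map_comp -[RHS]map_id.
by apply: eq_map => -[x b] /=; rewrite negbK.
Qed.

Lemma word_inv_cat (w1 w2 : word X) :
  word_inv (w1 ++ w2) = word_inv w2 ++ word_inv w1.
Proof. by rewrite /word_inv map_cat rev_cat. Qed.

Lemma pres_eq_invr w : pres_eq R (w ++ word_inv w) [::].
Proof.
elim: w => [|[x b] w IHw]; first exact: pres_refl.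
rewrite -cat1s word_inv_cat -catA [w ++ _]catA.
apply: pres_trans (pres_cancel R x b).
exact: (pres_cat (pres_refl R [:: (x, b)])
  (pres_cat IHw (pres_refl R (word_inv [:: (x, b)])))).
Qed.

Lemma pres_eq_invl w : pres_eq R (word_inv w ++ w) [::].
Proof. by rewrite -{2}[w]word_invK; apply: pres_eq_invr. Qed.

Lemma pres_mulA : associative pres_mul.
Proof.
elim/pres_class_ind=> w1; elim/pres_class_ind=> w2; elim/pres_class_ind=> w3.
by rewrite !pres_classM catA.
Qed.

Lemma pres_mul1 : left_id pres_one pres_mul.
Proof. by elim/pres_class_ind=> w; rewrite pres_classM. Qed.

Lemma pres_mulr1 : right_id pres_one pres_mul.
Proof. by elim/pres_class_ind=> w; rewrite pres_classM cats0. Qed.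

Lemma pres_mulV : left_inverse pres_one pres_inv pres_mul.
Proof.
move=> a; rewrite -[in X in pres_mul _ X](reprK a) pres_classM.
by apply/pres_classP/pres_eq_invl.
Qed.

Lemma pres_mulrV : right_inverse pres_one pres_inv pres_mul.
Proof.
move=> a; rewrite -[in X in pres_mul X _](reprK a) pres_classM.
by apply/pres_classP/pres_eq_invr.
Qed.

HB.instance Definition _ := isGroup.Build presented
  pres_mulA pres_mul1 pres_mulr1 pres_mulV pres_mulrV.

End Presentation.

Record sgraph := SGraph {
  vertex :> choiceType;
  edge : rel vertex;
  edge_sym : symmetric edge;
  edge_irr : irreflexive edge }.

Lemma induced_sym (G : sgraph) (S : set G) :
  symmetric (fun x y : S => edge (val x) (val y)).
Proof. by move=> x y; apply: edge_sym. Qed.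

Lemma induced_irr (G : sgraph) (S : set G) :
  irreflexive (fun x y : S => edge (val x) (val y)).
Proof. by move=> x; apply: edge_irr. Qed.

Definition induced_subgraph (G : sgraph) (S : set G) : sgraph :=
  SGraph (@induced_sym G S) (@induced_irr G S).

Definition sgraph_iso (G H : sgraph) : Prop :=
  exists f : G -> H, bijective f /\ {mono f : x y / edge x y}.

Definition graph_free (L G : sgraph) : Prop :=
  ~ exists S : set G, sgraph_iso (induced_subgraph S) L.

Lemma compl_sym (G : sgraph) :
  symmetric (fun x y : G => (x != y) && ~~ edge x y).
Proof. by move=> x y; rewrite eq_sym edge_sym. Qed.

Lemma compl_irr (G : sgraph) :
  irreflexive (fun x y : G => (x != y) && ~~ edge x y).
Proof. by move=> x; rewrite eqxx. Qed.

Definition compl_graph (G : sgraph) : sgraph :=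
  SGraph (@compl_sym G) (@compl_irr G).

(* ordS is the cyclic successor; the cycle of length n is meant for n >= 3,
   and the condition i != j only matters for n = 1. *)
Definition cycle_edge n : rel 'I_n :=
  fun i j => (i != j) && ((j == ordS i) || (i == ordS j)).

Lemma cycle_sym n : symmetric (@cycle_edge n).
Proof. by move=> i j; rewrite /cycle_edge eq_sym orbC. Qed.

Lemma cycle_irr n : irreflexive (@cycle_edge n).
Proof. by move=> i; rewrite /cycle_edge eqxx. Qed.

Definition cycle_graph (n : nat) : sgraph :=
  SGraph (@cycle_sym n) (@cycle_irr n).

Definition triangle_free (G : sgraph) : Prop := graph_free (cycle_graph 3) G.

Definition square_free (G : sgraph) : Prop := graph_free (cycle_graph 4) G.

Definition weakly_chordal (G : sgraph) : Prop :=
  forall n, 5 <= n ->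
    graph_free (cycle_graph n) G /\ graph_free (compl_graph (cycle_graph n)) G.

Definition bipartite (G : sgraph) : Prop :=
  exists c : G -> bool, forall x y, edge x y -> c x != c y.

Definition comm_word (X : Type) (x y : X) : word X :=
  [:: (x, true); (y, true); (x, false); (y, false)].

Definition raag (G : sgraph) : groupType :=
  presented [set r | exists x y : G, edge x y /\ r = comm_word x y].

Definition raag_gen (G : sgraph) (v : G) : raag G :=
  pres_class _ [:: (v, true)].

Lemma commuting_sym (A : groupType) :
  symmetric (fun x y : A => (x != y) && `[< commute x y >]).
Proof.
move=> x y; rewrite eq_sym; congr (_ && _).
by apply/asboolP/asboolP => /commute_sym.
Qed.

Lemma commuting_irr (A : groupType) :
  irreflexive (fun x y : A => (x != y) && `[< commute x y >]).
Proof. by move=> x; rewrite eqxx. Qed.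

Definition commuting_graph (A : groupType) : sgraph :=
  SGraph (@commuting_sym A) (@commuting_irr A).

Definition extension_graph (G : sgraph) : sgraph :=
  @induced_subgraph (commuting_graph (raag G))
    [set x | exists (v : G) (g : raag G), x = raag_gen v ^ g].

(* Main.v *)
(** Write A for the right-angled Artin group of G. In the Cayley graph of A
    with edges g -- v g, the edges dual to a hyperplane are those of the form
    l h -- v l h with l in <Lk v>, and the parity of the number of crossings is
    well defined because both pairs of opposite sides of a commutation square
    are dual to the same hyperplanes. This yields two halfspaces, and counting
    crossings along the sides of a long rectangle shows that commuting
    conjugates of generators lie in a common conjugate of G, and that the
    centralizer of v is <St v>. In particular v ^ g |-> v is a graph morphism
    from the extension graph to G, which settles triangles and bipartiteness.

    For the rest, a finite induced subgraph lies in the union of the conjugates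
    G ^ g, where g runs through a finite walk in the Cayley graph. Take the
    hyperplane dual to the first edge h -- v h of the walk and fold the
    extension graph along it: vertices on one side are conjugated by the
    inverse of x = v ^ h, which fixes the star of x. This shortens the walk, and
    ends in a single conjugate of G. A forbidden subgraph that is destroyed by
    the fold has vertices on both sides of the star of x, and then one finds
    another one inside the union of its image with x. *)

Require Import Defs.
From mathcomp Require Import all_boot ssralg ssrint zify.
From mathcomp Require Import boolp classical_sets cardinality.
Set Implicit Arguments.
Unset Strict Implicit.
Unset Printing Implicit Defensive.

(** * Hyperplanes in right-angled Artin groups *)

Section Raag.
Local Open Scope group_scope.
Local Open Scope classical_set_scope.
Variable G : sgraph.
Implicit Types (u v : G) (w : word G) (g h : raag G) (T : pred G).

(** * Words and special subgroups *)

Definition word_val w : raag G := pres_class _ w.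

Definition word_over T w := all (fun l => T l.1) w.

Definition in_span T g := exists2 w, word_over T w & g = word_val w.

Definition in_star u : pred G := fun v => (v == u) || edge u v.

Lemma word_val_nil : word_val [::] = 1.
Proof. by []. Qed.

Lemma word_val_cat w1 w2 : word_val (w1 ++ w2) = word_val w1 * word_val w2.
Proof. by rewrite -[RHS]/(pres_mul _ _) pres_classM. Qed.

Lemma word_val_surj g : exists w, g = word_val w.
Proof. by exists (repr g); rewrite /word_val /pres_class reprK. Qed.

Definition letter_val (l : G * bool) : raag G :=
  if l.2 then raag_gen l.1 else (raag_gen l.1)^-1.

Lemma word_val_cons l w : word_val (l :: w) = letter_val l * word_val w.
Proof.
rewrite -cat1s word_val_cat; congr (_ * _); case: l => u [] //.
apply: (mulgI (raag_gen u)); rewrite mulgV -[raag_gen u]/(word_val [:: (u, true)]).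
rewrite -word_val_cat.
by apply/pres_classP; exact: (pres_cancel _ u true).
Qed.

Lemma word_val_inv w : word_val (word_inv w) = (word_val w)^-1.
Proof.
apply: (mulgI (word_val w)); rewrite mulgV -word_val_cat.
by apply/pres_classP; apply: pres_eq_invr.
Qed.

Lemma raag_gen_comm u v : edge u v -> commute (raag_gen u) (raag_gen v).
Proof.
move=> euv; have: word_val (comm_word u v) = 1.
  by apply/pres_classP/pres_relator; exists u, v.
rewrite !word_val_cons word_val_nil mulg1 /letter_val /= !mulgA => /eqP.
by rewrite mulg_eq1 invgK => /eqP e; rewrite /commute -[in RHS]e mulgVK.
Qed.

Lemma in_star_comm u v : in_star u v -> commute (raag_gen u) (raag_gen v).
Proof. by case/orP=> [/eqP ->|/raag_gen_comm]. Qed.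

Lemma in_span1 T : in_span T 1.
Proof. by exists [::]. Qed.

Lemma in_spanM T g h : in_span T g -> in_span T h -> in_span T (g * h).
Proof.
move=> [w1 T1 ->] [w2 T2 ->]; exists (w1 ++ w2); last by rewrite word_val_cat.
by rewrite /word_over all_cat; apply/andP.
Qed.

Lemma in_spanV T g : in_span T g -> in_span T g^-1.
Proof.
case=> w Tw ->; exists (word_inv w); last by rewrite word_val_inv.
by rewrite /word_over /word_inv all_rev all_map.
Qed.

Lemma in_span_letter (T : pred G) l : T l.1 -> in_span T (letter_val l).
Proof.
move=> Tl; exists [:: l]; first by rewrite /word_over /= Tl.
by rewrite word_val_cons word_val_nil mulg1.
Qed.

Lemma in_span_gen (T : pred G) u : T u -> in_span T (raag_gen u).
Proof. exact: (in_span_letter (l := (u, true))). Qed.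

Lemma in_spanMl T g h : in_span T g -> in_span T (g * h) <-> in_span T h.
Proof.
move=> Tg; split=> [Tgh|]; last exact: in_spanM.
by rewrite -(mulKg g h); apply: in_spanM => //; apply: in_spanV.
Qed.

Lemma in_spanX T g n : in_span T g -> in_span T (g ^+ n).
Proof.
move=> Tg; elim: n => [|n IHn]; first exact: in_span1.
by rewrite expgS; apply: in_spanM.
Qed.

Lemma in_spanS (T T' : pred G) g : subpred T T' -> in_span T g -> in_span T' g.
Proof. by move=> sTT' [w Tw ->]; exists w => //; apply: sub_all Tw => l /sTT'. Qed.

Lemma in_span_comm u g : in_span (in_star u) g -> commute (raag_gen u) g.
Proof.
case=> w + ->; elim: w => [|[v b] w IHw] /=; first by move=> _; apply: commute1.
case/andP=> /= sv /IHw cw; rewrite word_val_cons; apply: commuteM => //.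
case: b; first exact: in_star_comm.
by apply/commuteV/in_star_comm.
Qed.

(* Whether the edge from g to l g of the Cayley graph is dual to the hyperplane that
   separates 1 from v; its lower end is g or l g, depending on the sign of l. *)
Definition crosses v (l : G * bool) g : bool :=
  (l.1 == v) &&
  `[< in_span (edge v) (if l.2 then g else letter_val l * g) >].

(** Multiplication is on the left: [w] is read from the right, as the path from [g] to
    [word_val w * g]. *)
Fixpoint crossing_parity v w g : bool :=
  if w is l :: w' then
    crosses v l (word_val w' * g) (+) crossing_parity v w' g
  else false.

Lemma crossing_parity_cat v w1 w2 g :
  crossing_parity v (w1 ++ w2) g =
  crossing_parity v w1 (word_val w2 * g) (+) crossing_parity v w2 g.
Proof.
by elim: w1 => [|l w1 IHw] //=; rewrite IHw word_val_cat -mulgA addbA.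
Qed.

Lemma in_spanEl T g h : in_span T g ->
  `[< in_span T (g * h) >] = `[< in_span T h >].
Proof. by move=> Tg; apply/asboolP/asboolP; rewrite in_spanMl. Qed.

Lemma in_spanVEl T g h : in_span T g ->
  `[< in_span T (g^-1 * h) >] = `[< in_span T h >].
Proof. by move=> Tg; apply/in_spanEl/in_spanV. Qed.

(** A cancelling pair uses the same edge twice. In a commutation square with one letter [v], the two
    sides labelled [v] differ by left multiplication by the other generator, which lies in the link
    group. *)
Lemma crossing_parity_eq v w1 w2 :
  pres_eq [set r | exists x y : G, edge x y /\ r = comm_word x y] w1 w2 ->
  forall g, crossing_parity v w1 g = crossing_parity v w2 g.
Proof.
elim=> {w1 w2} [w|w1 w2 _ IH|w1 w2 w3 _ IH1 _ IH2|w1 w1' w2 w2' h1 IH1 h2 IH2|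
  x b|r [x [y [exy ->]]]] g //.
- by rewrite IH1.
- rewrite !crossing_parity_cat IH1 IH2; congr (crossing_parity _ _ (_ * _) (+) _).
  by apply/pres_classP.
- rewrite /= /crosses /= addbF mul1g word_val_cons word_val_nil mulg1.
  case: (x == v) => //=; case: b => /=; rewrite /letter_val /=.
    by rewrite addbb.
  by rewrite mulKg addbb.
rewrite /= /crosses /= addbF mul1g.
rewrite !word_val_cons word_val_nil /letter_val /=.
case: (x =P v) => [xv|_]; case: (y =P v) => [yv|_] /=; rewrite ?addbF //.
- by move: exy; rewrite xv yv edge_irr.
- have Ty : in_span (edge v) (raag_gen y) by apply: in_span_gen; rewrite -xv.
  by rewrite ?mul1g ?mulg1 -?mulgA (in_spanEl _ Ty) addbb.
- have Tx : in_span (edge v) (raag_gen x).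
    by apply: in_span_gen; rewrite -yv edge_sym.
  by rewrite ?mul1g ?mulg1 -?mulgA (in_spanVEl _ Tx) addbb.
Qed.

Definition halfspace v g : bool := crossing_parity v (repr g) 1.

Lemma halfspace_word v w : halfspace v (word_val w) = crossing_parity v w 1.
Proof. exact/crossing_parity_eq/pres_repr. Qed.

Lemma halfspace_cat v w g :
  halfspace v (word_val w * g) = crossing_parity v w g (+) halfspace v g.
Proof.
have [w' ->] := word_val_surj g.
by rewrite -word_val_cat !halfspace_word crossing_parity_cat mulg1.
Qed.

Lemma halfspace1 v : halfspace v 1 = false.
Proof. by rewrite -word_val_nil halfspace_word. Qed.

Lemma halfspace_letter v l g :
  halfspace v (letter_val l * g) = crosses v l g (+) halfspace v g.
Proof.
rewrite -[letter_val l]mulg1 -word_val_nil -word_val_cons halfspace_cat /=.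
by rewrite mul1g addbF.
Qed.

(** A path that changes sides has an edge dual to the hyperplane; [w'] is the suffix of [w] leading
    to its lower end. *)
Lemma halfspace_crossing (T : pred G) v w g : word_over T w ->
  halfspace v (word_val w * g) != halfspace v g ->
  T v /\ exists w', [/\ word_over T w', size w' <= size w &
    in_span (edge v) (word_val w' * g)].
Proof.
elim: w => [|l w IHw] /=; first by rewrite mul1g eqxx.
case/andP=> Tl Tw; rewrite word_val_cons -mulgA halfspace_letter.
case cr: (crosses v l _); last first.
  move=> /IHw[] // Tv [w' [? s ?]]; split=> //; exists w'; split=> //.
  exact: ltnW.
case/andP: cr => /eqP lv /asboolP cr _; rewrite -lv; split=> //.
rewrite lv; case: (l.2) cr => cr; first by exists w; split.
exists (l :: w); split=> //=; first by rewrite Tl.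
by rewrite word_val_cons -mulgA.
Qed.

(** * Exponent sums and powers of a generator *)

Fixpoint exponent v w : int :=
  if w is l :: w' then
    ((if l.1 == v then (if l.2 then 1 else -1) else 0) + exponent v w')%R
  else 0%R.

Lemma exponent_cat v w1 w2 :
  exponent v (w1 ++ w2) = (exponent v w1 + exponent v w2)%R.
Proof. by elim: w1 => [|l w1 IHw] /=; rewrite ?IHw; lia. Qed.

Lemma exponent_eq v w1 w2 :
  pres_eq [set r | exists x y : G, edge x y /\ r = comm_word x y] w1 w2 ->
  exponent v w1 = exponent v w2.
Proof.
elim=> {w1 w2} [w|w1 w2 _ IH|w1 w2 w3 _ IH1 _ IH2|w1 w1' w2 w2' h1 IH1 h2 IH2|
  x b|r [x [y [exy ->]]]] //.
- by rewrite IH1.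
- by rewrite !exponent_cat IH1 IH2.
- by rewrite /=; case: (x == v); case: b.
by rewrite /=; case: (x == v); case: (y == v).
Qed.

Definition gexponent v g : int := exponent v (repr g).

Lemma gexponent_word v w : gexponent v (word_val w) = exponent v w.
Proof. exact/exponent_eq/pres_repr. Qed.

Lemma gexponentM v g h :
  gexponent v (g * h) = (gexponent v g + gexponent v h)%R.
Proof.
have [w ->] := word_val_surj g; have [w' ->] := word_val_surj h.
by rewrite -word_val_cat !gexponent_word exponent_cat.
Qed.

Lemma gexponent1 v : gexponent v 1 = 0%R.
Proof. by rewrite -word_val_nil gexponent_word. Qed.

Lemma gexponentV v g : gexponent v g^-1 = (- gexponent v g)%R.
Proof. by have := gexponentM v g g^-1; rewrite mulgV gexponent1; lia. Qed.

Lemma gexponentX v n : gexponent v (raag_gen v ^+ n) = Posz n.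
Proof.
elim: n => [|n IHn]; first exact: gexponent1.
rewrite expgS gexponentM IHn -[raag_gen v]mulg1.
rewrite -(word_val_cons (v, true) [::]) gexponent_word /= eqxx; lia.
Qed.

Lemma exponent_size v w : (`|exponent v w| <= size w)%N.
Proof. by elim: w => [|[u b] w IHw] //=; case: (u == v); case: b; lia. Qed.

(** With [exponent_size], a point whose exponent of [v] exceeds [N] in absolute value cannot be
    joined to the link group by [N] letters. *)
Lemma gexponent_link v g : in_span (edge v) g -> gexponent v g = 0%R.
Proof.
case=> w + ->; rewrite gexponent_word; elim: w => [|l w IHw] //= /andP[lv /IHw ->].
by case: eqP lv => [->|//]; rewrite edge_irr.
Qed.

Lemma halfspace_pos v n : halfspace v (raag_gen v ^+ n.+1).
Proof.
elim: n => [|n IHn]; rewrite expgS -[raag_gen v]/(letter_val (v, true));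
  rewrite halfspace_letter /crosses eqxx /=.
  by rewrite halfspace1 expg0 asboolT //; apply: in_span1.
(* Every edge after the first starts at a nonzero power of [v], which its exponent keeps out of the
   link group. *)
rewrite IHn asboolF // => /gexponent_link.
by rewrite gexponentX.
Qed.

Lemma halfspace_neg v n : halfspace v (raag_gen v ^- n) = false.
Proof.
elim: n => [|n IHn]; first by rewrite invg1 halfspace1.
rewrite expgSr invgM -[_^-1]/(letter_val (v, false)).
rewrite halfspace_letter /crosses eqxx /=.
rewrite IHn asboolF // /letter_val /= -invgM -expgSr.
by move=> /gexponent_link; rewrite gexponentV gexponentX.
Qed.

(* Translate the hyperplane dual to v by a power of v so that it meets neither
   the path from 1 to g nor its translate by v ^+ n; it separates 1 from v ^+ n,
   so it must meet the path from g to g * v ^+ n inside <T> g. *)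
Lemma conj_in_span (T : pred G) v g : in_span T (g * raag_gen v * g^-1) ->
  T v /\ exists2 s, in_span T s & in_span (in_star v) (s * g).
Proof.
move=> Tk; have [w gw] := word_val_surj g; set N := size w.
(* The word for [g] has length [N], so the offset [N.+1] keeps exponents nonzero along it; the
   conjugate of [x ^+ n], where [n] is twice [N.+1], carries [g * x ^- N.+1] to [g * x ^+ N.+1]. *)
set x := raag_gen v in Tk *; set n := (N.*2.+2)%N.
have no_cross h : (forall w', size w' <= N ->
    (gexponent v (word_val w' * h) != 0%R)) ->
    halfspace v (g * h) = halfspace v h.
  move=> far; apply/eqP/negPn/negP; rewrite gw.
  case/(halfspace_crossing (T := predT)); first exact: all_predT.
  by move=> _ [w' [_ /far/eqP + /gexponent_link]].
have h1 : halfspace v (g * x ^- N.+1) = false.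
  rewrite no_cross ?halfspace_neg // => w' sw.
  rewrite gexponentM gexponentV gexponentX gexponent_word.
  by have := exponent_size v w'; lia.
have h2 : halfspace v (g * x ^+ N.+1) = true.
  rewrite no_cross ?halfspace_pos // => w' sw.
  rewrite gexponentM gexponentX gexponent_word.
  by have := exponent_size v w'; lia.
have Tkn : in_span T (g * x ^+ n * g^-1).
  have := in_spanX n Tk; congr in_span.
  have := conjXg x g^-1 n; rewrite !conjgE invgK !mulgA => ->.
  by [].
have [w' Tw' kw'] := Tkn.
have : halfspace v (word_val w' * (g * x ^- N.+1)) != halfspace v (g * x ^- N.+1).
  rewrite h1 -kw' -mulgA mulKg -mulgA -expgnFr; last by rewrite /n; lia.
  by rewrite [(n - _)%N](_ : _ = N.+1) ?h2 // /n; lia.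
case/(halfspace_crossing Tw') => Tv [w'' [Tw'' _ h3]]; split=> //.
exists (word_val w''); first by exists w''.
(* Returning to [g] costs a power of [v], whence the star group in place of the link group. *)
have : in_span (in_star v) (word_val w'' * (g * x ^- N.+1)).
  by apply: in_spanS h3 => u euv; rewrite /in_star euv orbT.
rewrite mulgA => h4; rewrite -[_ * g](mulgVK (x ^+ N.+1)).
by apply: in_spanM h4 _; apply/in_spanX/in_span_gen; rewrite /in_star eqxx.
Qed.

(** For a singleton [T], the [s] of [conj_in_span] is a power of [u], which the star group absorbs.
    With [u = v] this gives the centralizer of a generator. *)
Lemma conj_gen_eq u v g : raag_gen u = raag_gen v ^ g ->
  u = v /\ in_span (in_star u) g.
Proof.
move=> eq; have : in_span (pred1 u) (g^-1 * raag_gen v * g^-1^-1).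
  by rewrite invgK -mulgA -conjgE -eq; apply: in_span_gen => /=.
case/conj_in_span => /= /eqP vu [s Ts]; rewrite vu => sg; split=> //.
rewrite -[g]invgK; apply: in_spanV; rewrite -(mulKg s g^-1).
apply: in_spanM sg; apply: in_spanV; apply: in_spanS Ts => z /= /eqP ->.
by rewrite /in_star eqxx.
Qed.

Lemma conj_eq u v g h : raag_gen u ^ g = raag_gen v ^ h ->
  u = v /\ exists2 s, in_span (in_star u) s & h = s * g.
Proof.
move=> eq; have /conj_gen_eq[-> hu] : raag_gen u = raag_gen v ^ (h * g^-1).
  by rewrite conjgM -eq conjgK.
by split=> //; exists (h * g^-1); rewrite ?mulgVK.
Qed.

Lemma conj_span u g h : in_span (in_star u) g ->
  raag_gen u ^ (g * h) = raag_gen u ^ h.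
Proof. by move/in_span_comm=> c; rewrite conjgM [_ ^ g]conjgE c mulKg. Qed.

Lemma conj_comm u v g h : commute (raag_gen u ^ g) (raag_gen v ^ h) ->
  in_star u v /\
  exists k, raag_gen u ^ g = raag_gen u ^ k /\ raag_gen v ^ h = raag_gen v ^ k.
Proof.
move=> c; pose k := h * g^-1.
have ck : commute (raag_gen u) (raag_gen v ^ k).
  rewrite conjgM -[raag_gen u](conjgK g) /commute -!conjMg.
  by congr (_ ^ _).
have /conj_gen_eq[_ ks] : raag_gen u = raag_gen u ^ (raag_gen v ^ k).
  by rewrite [RHS]conjgE ck mulKg.
have : in_span (in_star u) (k^-1 * raag_gen v * k^-1^-1).
  by rewrite invgK -mulgA -conjgE.
(* [s] centralizes [raag_gen u], and [s * g] differs from [h] by the element [s * k^-1] of the star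
   group of [v], so [s * g] conjugates both generators as required. *)
case/conj_in_span => uv [s us vs]; split=> //; exists (s * g).
split; first by rewrite conj_span.
have -> : s * g = (s * k^-1) * h by rewrite /k invgM invgK -!mulgA mulVg mulg1.
by rewrite conj_span.
Qed.

End Raag.

(** * Folding cycles and anticycles *)

(** Numbering by [nat] lets copies be reindexed freely. The diagonal is excluded because
    [cyclic_nonadj m] holds there for [m >= 2]. *)
Definition induced_copy (E : sgraph) m (r : rel nat) (c : nat -> E) :=
  forall i j, i < m -> j < m -> i != j ->
    c i != c j /\ edge (c i) (c j) = r i j.

Definition cyclic_adj m : rel nat := fun i j =>
  [|| j == i.+1, i == j.+1, (i == 0) && (j.+1 == m) | (j == 0) && (i.+1 == m)].

Definition cyclic_nonadj m : rel nat := fun i j => ~~ cyclic_adj m i j.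

Definition rotate m k i := if i + k < m then i + k else i + k - m.

Lemma rotateP m k i : k < m -> i < m ->
  rotate m k i < m /\ (rotate m k i = i + k \/ rotate m k i + m = i + k).
Proof. by rewrite /rotate; case: ifP; lia. Qed.

Lemma rotate_lt m k i : k < m -> i < m -> rotate m k i < m.
Proof. by move=> km /(rotateP km)[]. Qed.

Lemma rotate_neq m k i j : k < m -> i < m -> j < m -> i != j ->
  rotate m k i != rotate m k j.
Proof.
by move=> km im jm; have := rotateP km im; have := rotateP km jm; lia.
Qed.

Lemma rotate_onto m k i : k < m -> i < m ->
  exists2 j, j < m & rotate m k j = i.
Proof.
move=> km im; exists (if k <= i then i - k else i + m - k).
  by case: ifP; lia.
by rewrite /rotate; case: (leqP k i) => ki; case: ifP; lia.
Qed.

Lemma rotate_adj m k i j : k < m -> i < m -> j < m ->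
  cyclic_adj m (rotate m k i) (rotate m k j) = cyclic_adj m i j.
Proof.
rewrite /cyclic_adj => km im jm.
have := rotateP km im; have := rotateP km jm; move: (rotate m k i) (rotate m k j).
by lia.
Qed.

Section Copies.
Variable E : sgraph.
Implicit Types (c : nat -> E) (r : rel nat).

Lemma induced_copy_sub m m' r r' c (s : nat -> nat) :
  (forall i, i < m' -> s i < m) ->
  (forall i j, i < m' -> j < m' -> i != j ->
     s i != s j /\ r (s i) (s j) = r' i j) ->
  induced_copy m r c -> induced_copy m' r' (c \o s).
Proof.
move=> sm sr cc i j im jm ij; have [sij <-] := sr i j im jm ij.
by apply: cc => //; apply: sm.
Qed.

Lemma induced_copy_rotate m k c : k < m ->
  induced_copy m (cyclic_adj m) c ->
  induced_copy m (cyclic_adj m) (c \o rotate m k).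
Proof.
move=> km; apply: induced_copy_sub => [i|i j im jm ij]; first exact: rotate_lt.
by rewrite rotate_neq // rotate_adj.
Qed.

Lemma induced_copy_rotateN m k c : k < m ->
  induced_copy m (cyclic_nonadj m) c ->
  induced_copy m (cyclic_nonadj m) (c \o rotate m k).
Proof.
move=> km; apply: induced_copy_sub => [i|i j im jm ij]; first exact: rotate_lt.
by rewrite rotate_neq // /cyclic_nonadj rotate_adj.
Qed.

Lemma induced_copy_lt m r c : symmetric r ->
  (forall i j, i < j < m -> c i != c j /\ edge (c i) (c j) = r i j) ->
  induced_copy m r c.
Proof.
move=> rsym h i j im jm; case: (ltngtP i j) => // ij _.
  by apply: h; rewrite ij.
by rewrite eq_sym edge_sym rsym; apply: h; rewrite ij.
Qed.

End Copies.

(** * Arithmetic of cyclic adjacency *)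

Lemma cyclic_neighbor_sep m j : 5 <= m -> 1 < j < m.-1 ->
  exists a, [/\ a < m, a != 0, a != j, a = 1 \/ a = m.-1 &
    cyclic_adj m 0 a && ~~ cyclic_adj m j a].
Proof.
move=> m5 jm; exists (if j == 2 then m.-1 else 1).
by case: eqP => j2; split; rewrite /cyclic_adj; lia.
Qed.

(** For the path a, 0, j, b that the centre closes to a pentagon once a fold joins 0 and j. In a
    cycle of length 5 such a and b would be adjacent. *)
Lemma cyclic_neighbors_far m j : 6 <= m -> 1 < j < m.-1 ->
  exists a b, [/\ a < m, b < m, a = 1 \/ a = m.-1 & b = j.+1 \/ b = j.-1] /\
    [/\ a != b, 0 != a, 0 != b, a != j & j != b] /\
    [/\ cyclic_adj m a 0, cyclic_adj m 0 b = false, cyclic_adj m a j = false,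
        cyclic_adj m j b & cyclic_adj m a b = false].
Proof.
move=> m6 jm; exists (if j == 2 then m.-1 else 1).
exists (if j.+2 == m then j.-1 else j.+1).
by case: eqP => j2; case: eqP => jm2; do !split; rewrite /cyclic_adj; lia.
Qed.

Lemma cyclic_adj0 m k : 3 <= m -> k < m ->
  cyclic_adj m 0 k = (k == 1) || (k == m.-1).
Proof. by move=> m3 km; rewrite /cyclic_adj; lia. Qed.

Lemma cyclic_adj1 m k : 3 <= m -> k < m ->
  cyclic_adj m 1 k = (k == 0) || (k == 2).
Proof. by move=> m3 km; rewrite /cyclic_adj; lia. Qed.

Lemma cyclic_small m : 5 <= m ->
  [/\ 0 < m, 1 < m, 2 < m, m.-1 < m & 3 <= m] /\
  [/\ 2 != m.-1, 1 != m.-1, ~~ cyclic_adj m 0 2, ~~ cyclic_adj m 1 m.-1 &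
    ~~ cyclic_adj m 2 m.-1].
Proof. by move=> m5; rewrite /cyclic_adj; do !split; lia. Qed.

Lemma cyclic_mid m k : 3 <= k < m.-1 ->
  [/\ k < m, 0 != k, 1 != k, ~~ cyclic_adj m 0 k & ~~ cyclic_adj m 1 k].
Proof. by move=> km; rewrite /cyclic_adj; split; lia. Qed.

Lemma cyclic_midP m k : k < m -> k != 0 -> k != 1 -> k != 2 -> k != m.-1 ->
  3 <= k < m.-1.
Proof. lia. Qed.

(** Rotation by 1 lists the cycle as 1, ..., m - 1, 0, so a vertex numbered [m] is inserted between
    0 and 1; the excluded pair is the edge it subdivides. *)
Lemma cyclic_adj_extend m k l : 3 <= m -> k < l < m ->
  ~~ ((k == 0) && (l == m.-1)) ->
  cyclic_adj m (rotate m 1 k) (rotate m 1 l) = cyclic_adj m.+1 k l.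
Proof.
move=> m3 klm kl; have [m1 km lm] : [/\ 1 < m, k < m & l < m] by split; lia.
rewrite rotate_adj // /cyclic_adj; lia.
Qed.

Lemma cyclic_adj_last m k : 3 <= m -> k < m ->
  cyclic_adj m.+1 k m = (rotate m 1 k < 2).
Proof.
move=> m3 km; have m1 : 1 < m by lia.
have := rotateP m1 km; rewrite /cyclic_adj; move: (rotate m 1 k); lia.
Qed.

Lemma cyclic_adj_sym m : symmetric (cyclic_adj m).
Proof. by move=> i j; rewrite /cyclic_adj; lia. Qed.

Lemma cyclic_nonadj_sym m : symmetric (cyclic_nonadj m).
Proof. by move=> i j; rewrite /cyclic_nonadj cyclic_adj_sym. Qed.

(** * Cycles and anticycles under a star fold *)

Definition unmixed_for (E : sgraph) (x : E) (side : E -> bool) (a b : E) :=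
  [|| in_star x a, in_star x b | side a == side b].

(* The star of x separates the vertices of each side, and phi folds one side
   onto the other; new adjacencies can only be created across the star. *)
Record star_fold (E : sgraph) (x : E) (side : E -> bool) (phi : E -> E) :
    Prop := StarFold {
  fold_star a : in_star x a -> phi a = a;
  fold_edge a b : unmixed_for x side a b -> edge (phi a) (phi b) = edge a b;
  fold_eq a b : unmixed_for x side a b -> (phi a == phi b) = (a == b);
  fold_side a b : ~~ in_star x a -> ~~ in_star x b -> edge a b ->
    side a = side b }.

Section Fold.
Variables (E : sgraph) (x : E) (side : E -> bool) (phi : E -> E).
Hypothesis sf : star_fold x side phi.
Implicit Types (c : nat -> E) (r : rel nat).

Local Notation star := (in_star x).
Local Notation unmixed := (unmixed_for x side).

Definition fold_image m c y := y = x \/ exists2 k, k < m & y = phi (c k).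

Lemma fold_center : phi x = x.
Proof. by apply: (fold_star sf); rewrite /in_star eqxx. Qed.

Lemma fold_image_center m c : fold_image m c (phi x).
Proof. by left; apply: fold_center. Qed.

Lemma fold_image_phi m c k : k < m -> fold_image m c (phi (c k)).
Proof. by move=> km; right; exists k. Qed.

Lemma fold_image_rotate m k c y : k < m ->
  fold_image m (c \o rotate m k) y -> fold_image m c y.
Proof.
move=> km [->|[i im ->]]; first by left.
by apply: fold_image_phi; apply: rotate_lt.
Qed.

Lemma fold_pair m r c k l : induced_copy m r c -> k < m -> l < m -> k != l ->
  unmixed (c k) (c l) ->
  phi (c k) != phi (c l) /\ edge (phi (c k)) (phi (c l)) = r k l.
Proof.
move=> cc km lm kl u; rewrite (fold_eq sf) // (fold_edge sf) //.
exact: cc.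
Qed.

Lemma fold_near a : edge x a -> x != phi a /\ edge x (phi a).
Proof.
move=> xa; have sa : star a by rewrite /in_star xa orbT.
rewrite (fold_star sf sa) xa; split=> //.
by apply: contraTneq xa => <-; rewrite edge_irr.
Qed.

Lemma fold_far a : ~~ star a -> x != phi a /\ edge x (phi a) = false.
Proof.
rewrite /in_star negb_or => /andP[ax /negPf xa].
have u : unmixed x a by rewrite /unmixed_for /in_star eqxx.
by rewrite -[x]fold_center (fold_eq sf) // (fold_edge sf) // xa eq_sym ax.
Qed.

Lemma mixedP a b : ~~ unmixed a b ->
  [/\ ~~ star a, ~~ star b & side a != side b].
Proof. by rewrite /unmixed_for !negb_or => /and3P. Qed.

Lemma unmixedC a b : unmixed a b = unmixed b a.
Proof. by rewrite /unmixed_for eq_sym orbCA. Qed.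

(** By [fold_side] the side stays constant until the cycle meets the star, so a path to the other
    side meets it; [q] is the first place where it does. *)
Lemma mixed_arc m c j : induced_copy m (cyclic_adj m) c -> j < m ->
  ~~ unmixed (c 0) (c j) ->
  exists q, [/\ 0 < q < j, star (c q) &
    forall i, i < q -> ~~ star (c i) /\ side (c i) = side (c 0)].
Proof.
move=> cc jm /mixedP[s0 sj sd].
have chain k : k <= j -> (forall i, i <= k -> ~~ star (c i)) ->
    side (c k) = side (c 0).
  elim: k => [//|k IHk] kj sk; rewrite -IHk; last 2 first.
  - exact: ltnW.
  - by move=> i ik; apply: sk; apply: leqW.
  symmetry; apply: (fold_side sf); [exact: sk|exact: sk|].
  by have [|||_ ->] := cc k k.+1; rewrite ?/cyclic_adj; lia.
have [q sq qmin] : exists2 q, (q < j) && star (c q) &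
    forall i, (i < j) && star (c i) -> q <= i.
  have ex : exists q, (q < j) && star (c q).
    have [//|ns] := pselect (exists q, (q < j) && star (c q)).
    case/eqP: sd; symmetry; apply: chain => // i; rewrite leq_eqVlt.
    by case/orP=> [/eqP->//|ij]; apply/negP => si; apply: ns; exists i; rewrite ij.
  by case: (ex_minnP ex) => q ? h; exists q.
case/andP: sq => qj sq.
have ns i : i < q -> ~~ star (c i).
  move=> iq; apply/negP => si; have := qmin i.
  by rewrite si (ltn_trans iq qj) => /(_ isT); lia.
exists q; split=> //.
  by rewrite qj andbT; case: q sq {qmin qj ns} => //; rewrite (negPf s0).
move=> i iq; split; first exact: ns.
by apply: chain => [|k ki]; [lia|apply: ns; lia].
Qed.

Definition reflect_index m i := if i == 0 then 0 else m - i.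

Lemma reflect_indexP m i : i < m ->
  reflect_index m i < m /\
  (i = 0 /\ reflect_index m i = 0 \/ reflect_index m i + i = m).
Proof. by rewrite /reflect_index; case: eqP; lia. Qed.

Lemma induced_copy_reflect m c : induced_copy m (cyclic_adj m) c ->
  induced_copy m (cyclic_adj m) (c \o reflect_index m).
Proof.
apply: induced_copy_sub => [i /reflect_indexP[]//|i j im jm ij].
have := reflect_indexP im; have := reflect_indexP jm; rewrite /cyclic_adj.
by move: (reflect_index m i) (reflect_index m j); lia.
Qed.

Lemma reflect_indexK m i : i < m -> reflect_index m (reflect_index m i) = i.
Proof.
move=> im; have [rm ri] := reflect_indexP im.
by have := reflect_indexP rm; lia.
Qed.

Lemma mixed_arcs m c j : induced_copy m (cyclic_adj m) c -> j < m ->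
  ~~ unmixed (c 0) (c j) ->
  exists q p, [/\ 0 < q < j, j < p < m, edge x (c q), edge x (c p) &
    forall i, i < m -> i < q \/ p < i ->
      ~~ star (c i) /\ side (c i) = side (c 0)].
Proof.
move=> cc jm mix; have [q [qj sq arcq]] := mixed_arc cc jm mix.
have [rm rj] := reflect_indexP jm.
have [|p' [pj sp arcp]] := mixed_arc (induced_copy_reflect cc) rm.
  by rewrite /= reflect_indexK.
have p'm : p' < m by lia.
have [pm pp] := reflect_indexP p'm; set p := reflect_index m p' in pm pp.
(* 0 and [j] separate [q] from [p] on the cycle; a vertex of the pair equal to [x] would be equal or
   adjacent to the other one, so neither is [x]. *)
have npq : c q != c p /\ ~~ edge (c q) (c p).
  by have [|||-> ->] := cc q p; rewrite ?/cyclic_adj; lia.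
exists q, p; split; try lia.
- move: sq sp; rewrite /in_star /= -/p => /orP[/eqP eq|//].
  by move: npq; rewrite -eq [c p == _]eq_sym => -[/negPf-> /negPf->].
- move: sq sp; rewrite /in_star /= -/p => + /orP[/eqP eq|//].
  by move: npq; rewrite -eq [edge _ (c q)]edge_sym => -[/negPf-> /negPf->].
move=> i im [/arcq//|pi]; have [ri rii] := reflect_indexP im.
have := arcp (reflect_index m i); rewrite /= reflect_indexK //.
by apply; lia.
Qed.

(** The arc from [p] through 0 to [q] is on one side except for its ends in the link of [x], so
    [phi] preserves it and [x] closes it up. It has [m - p] vertices before 0 and [q + 1] from 0
    on. *)
Lemma fold_shorten m c q p : 4 <= m -> induced_copy m (cyclic_adj m) c ->
  0 < q -> q + 1 < p < m -> edge x (c q) -> edge x (c p) ->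
  (forall i, i < m -> i < q \/ p < i ->
      ~~ star (c i) /\ side (c i) = side (c 0)) ->
  exists2 d, induced_copy (q + (m - p) + 2) (cyclic_adj (q + (m - p) + 2)) d &
    forall k, k < q + (m - p) + 2 -> fold_image m c (d k).
Proof.
move=> m4 cc q0 qp xq xp arc; set L := q + (m - p) + 2.
have pm : p < m by lia.
pose d k := if k is k'.+1 then c (rotate m p k') else x.
exists (phi \o d); last first.
  move=> [|k] kL /=; first exact: fold_image_center.
  by apply: fold_image_phi; apply: rotate_lt; lia.
apply: induced_copy_lt; first exact: cyclic_adj_sym.
move=> i j /andP[]; case: i j => [|i] [|j] //= ij jL; rewrite ?fold_center.
  have jm : j < m by lia.
  have [rm rj] := rotateP pm jm; move: (rotate m p j) rm rj => r rm rj.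
  have [rq|nrq] := eqVneq r q.
    by rewrite rq; have [-> ->] := fold_near xq; rewrite /cyclic_adj; lia.
  have [rp|nrp] := eqVneq r p.
    by rewrite rp; have [-> ->] := fold_near xp; rewrite /cyclic_adj; lia.
  have [||/fold_far[-> ->] _] := arc r; rewrite /cyclic_adj; lia.
have [im jm] : i < m /\ j < m by lia.
have ijn : i != j by lia.
have := rotate_neq pm im jm ijn.
have := rotateP pm im; have := rotateP pm jm.
move: (rotate m p i) (rotate m p j) => r s [sm sj] [rm ri] rs.
have [||||-> ->] := fold_pair cc (k := r) (l := s) => //; last first.
  by rewrite /cyclic_adj; lia.
rewrite /unmixed_for /in_star.
have [->|nrq] := eqVneq r q; first by rewrite xq orbT.
have [->|nrp] := eqVneq r p; first by rewrite xp orbT.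
have [->|nsq] := eqVneq s q; first by rewrite xq !orbT.
have [->|nsp] := eqVneq s p; first by rewrite xp !orbT.
have [|| _ ->] := arc r; try lia; have [|| _ ->] := arc s; try lia.
Qed.

(** A mixed pair is nonadjacent by [fold_side], so [phi] can spoil a copy only by merging or joining
    such a pair. *)
Lemma fold_copy_or_mixed m r c : induced_copy m r c ->
  induced_copy m r (phi \o c) \/
  exists i j, [/\ i < m, j < m, i != j & ~~ unmixed (c i) (c j)] /\
    (phi (c i) = phi (c j) \/ edge (phi (c i)) (phi (c j))).
Proof.
move=> cc; have [?|ne] := pselect (exists i j, [/\ i < m, j < m, i != j &
    ~~ unmixed (c i) (c j)] /\
    (phi (c i) = phi (c j) \/ edge (phi (c i)) (phi (c j)))).
  by right.
left=> i j im jm ij; have [u|mix] := boolP (unmixed (c i) (c j)).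
  exact: (fold_pair cc).
have [si sj sd] := mixedP mix; have [_ <-] := cc i j im jm ij; split.
  by apply/eqP => eq; case: ne; exists i, j; split=> //; left.
have -> : edge (c i) (c j) = false.
  by apply: contraNF sd => /(fold_side sf si sj) ->.
by apply/negP => eq; case: ne; exists i, j; split=> //; right.
Qed.

(** [fold_shorten] applies to any mixed pair; the length stays at least 4 because [q] and [m - p]
    are positive. *)
Lemma fold_cycle4 m c : 4 <= m -> induced_copy m (cyclic_adj m) c ->
  exists L d, [/\ 4 <= L <= m, induced_copy L (cyclic_adj L) d &
    forall k, k < L -> fold_image m c (d k)].
Proof.
move=> m4 cc; case: (fold_copy_or_mixed cc) => [ccphi|].
  exists m, (phi \o c); split=> //; first lia.
  by move=> k km; apply: fold_image_phi.
move=> [i [j [[im jm _ mix] _]]].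
have [j' j'm jj'] := rotate_onto im jm.
have i0 : rotate m i 0 = i by have := @rotateP m i 0; lia.
have cc' := induced_copy_rotate im cc.
have [|q [p [qj jp xq xp arc]]] := mixed_arcs cc' j'm; first by rewrite /= jj' i0.
have [||d dc dF] := fold_shorten m4 cc' _ _ xq xp arc; try lia.
eexists; exists d; split; [|exact: dc|]; first lia.
by move=> k /dF; apply: fold_image_rotate.
Qed.

(** The shortened cycle has length 4 only for [q = 1] and [p = m.-1], when both neighbours of [c 0]
    are in the link of [x]. *)
Lemma fold_cycle_arc m c j :
  5 <= m -> induced_copy m (cyclic_adj m) c -> j < m -> ~~ unmixed (c 0) (c j) ->
  (exists L d, [/\ 5 <= L <= m, induced_copy L (cyclic_adj L) d &
    forall k, k < L -> fold_image m c (d k)]) \/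
  [/\ 1 < j < m.-1, edge x (c 1) & edge x (c m.-1)].
Proof.
move=> m5 cc jm mix; have [q [p [qj jp xq xp arc]]] := mixed_arcs cc jm mix.
have [[q1 p1]|long] := pselect (q = 1 /\ p = m.-1).
  by right; rewrite -q1 -p1; split=> //; lia.
left; have [|||d dc dF] := fold_shorten _ cc _ _ xq xp arc; try lia.
by eexists; exists d; split; [|exact: dc|exact: dF]; lia.
Qed.

(** Applying [fold_cycle_arc] at 0 and at [j] leaves the case where all neighbours of both lie in
    the link of [x]. *)
Lemma fold_cycle5_mixed0 m c j :
  5 <= m -> induced_copy m (cyclic_adj m) c -> j < m -> ~~ unmixed (c 0) (c j) ->
  phi (c 0) = phi (c j) \/ edge (phi (c 0)) (phi (c j)) ->
  (exists L d, [/\ 5 <= L <= m, induced_copy L (cyclic_adj L) d &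
    forall k, k < L -> fold_image m c (d k)]) \/
  exists2 d, induced_copy 6 (cyclic_nonadj 6) d &
    forall k, k < 6 -> fold_image m c (d k).
Proof.
move=> m5 cc jm mix bad.
have m0 : 0 < m by lia.
have [long|[j1 x1 xm]] := fold_cycle_arc m5 cc jm mix; first by left.
have [j' j'm rj'] := rotate_onto jm m0.
have mix' : ~~ unmixed ((c \o rotate m j) 0) ((c \o rotate m j) j').
  rewrite /= rj' unmixedC (_ : rotate m j 0 = j) //.
  by have := @rotateP m j 0; lia.
have [[L [d [Lm dc dF]]]|] := 
  fold_cycle_arc m5 (induced_copy_rotate jm cc) j'm mix'.
  by left; exists L, d; split=> // i /dF; apply: fold_image_rotate.
rewrite /= => -[_ xj1 xjm].
have {}xj1 : edge x (c j.+1).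
  by move: xj1; rewrite (_ : rotate m j 1 = j.+1) //; have := @rotateP m j 1; lia.
have {}xjm : edge x (c j.-1).
  move: xjm; rewrite (_ : rotate m j m.-1 = j.-1) //.
  by have := @rotateP m j m.-1; lia.
have [s0 sj sd] := mixedP mix.
have pair a b : a < m -> b < m -> a != b -> edge x (c a) || edge x (c b) ->
    phi (c a) != phi (c b) /\ edge (phi (c a)) (phi (c b)) = cyclic_adj m a b.
  move=> am bm ab xab; apply: (fold_pair cc) => //.
  by rewrite /unmixed_for /in_star; case/orP: xab => ->; rewrite ?orbT.
(* Some neighbour of 0 is not adjacent to [j], and [phi] keeps both relations, so the images are
   distinct and hence adjacent. *)
have [neq0j e0j] : phi (c 0) != phi (c j) /\ edge (phi (c 0)) (phi (c j)).
  have [a [am a0 aj aE /andP[adj0 adjj]]] := cyclic_neighbor_sep m5 j1.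
  have xa : edge x (c a) by case: aE => ->.
  have neq : phi (c 0) != phi (c j).
    apply: contraNneq adjj => eq0j.
    have [|||| _ <-] := pair j a => //; rewrite ?xa ?orbT 1?eq_sym //.
    by have [|||| _] := pair 0 a; rewrite ?xa ?orbT 1?eq_sym // eq0j adj0.
  by case: bad neq => [->|]; rewrite ?eqxx.
have [f0 fj] := (fold_far s0, fold_far sj).
have [m6|m5'] : 6 <= m \/ m = 5 by clear -m5; lia.
  left; have [a [b [[am bm aE bE] [[nab a0 b0 aj bj] [ra0 r0b raj rjb rab]]]]] :=
    cyclic_neighbors_far m6 j1.
  have xa : edge x (c a) by case: aE => ->.
  have xb : edge x (c b) by case: bE => ->.
  have [fa fb] := (fold_near xa, fold_near xb).
  exists 5, (phi \o nth x [:: x; c a; c 0; c j; c b]); split=> //; last first.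
    move=> [|[|[|[|[|k]]]]] //= _; try exact: fold_image_phi.
    exact: fold_image_center.
  apply: induced_copy_lt => [|k l]; first exact: cyclic_adj_sym.
  case/andP; case: k l => [|[|[|[|[|k]]]]] [|[|[|[|[|l]]]]] //= _ _;
    rewrite ?fold_center //.
  - by have [||||-> ->] := pair a 0; rewrite ?xa // eq_sym.
  - by have [||||-> ->] := pair a j; rewrite ?xa.
  - by have [||||-> ->] := pair a b; rewrite ?xa.
  - by have [||||-> ->] := pair 0 b; rewrite ?xb ?orbT.
  - by have [||||-> ->] := pair j b; rewrite ?xb ?orbT.
(* For [m = 5], [q] is the common neighbour of 0 and [j]; [p] and [s] are their other neighbours. *)
right; have prism p q s : p < m -> q < m -> s < m ->
    [/\ edge x (c p), edge x (c q) & edge x (c s)] ->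
    [/\ 0 != p, 0 != q, 0 != s, j != p & j != q] /\
      [/\ j != s, p != q, p != s & q != s] ->
    [/\ cyclic_adj m 0 p, cyclic_adj m 0 q, cyclic_adj m 0 s = false,
      cyclic_adj m j p = false & cyclic_adj m j q] /\
    [/\ cyclic_adj m j s, cyclic_adj m p q = false, cyclic_adj m p s &
      cyclic_adj m q s = false] ->
    exists2 d, induced_copy 6 (cyclic_nonadj 6) d &
      forall k, k < 6 -> fold_image m c (d k).
  move=> pm qm sm [xp xq xs] [[p0 q0 s0' pj qj] [sj' pq ps qs]].
  move=> [[r0p r0q r0s rjp rjq] [rjs rpq rps rqs]].
  have [fp fq fs] := And3 (fold_near xp) (fold_near xq) (fold_near xs).
  (* The complement of this copy is the hexagon x, j, p, q, s, 0. *)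
  exists (phi \o nth x [:: x; c j; c p; c q; c s; c 0]); last first.
    move=> [|[|[|[|[|[|k]]]]]] //= _; try exact: fold_image_phi.
    exact: fold_image_center.
  apply: induced_copy_lt => [|k l]; first exact: cyclic_nonadj_sym.
  case/andP; case: k l => [|[|[|[|[|[|k]]]]]] [|[|[|[|[|[|l]]]]]] //= _ _;
    rewrite ?fold_center //.
  - by have [||||-> ->] := pair j p; rewrite ?xp ?orbT.
  - by have [||||-> ->] := pair j q; rewrite ?xq ?orbT.
  - by have [||||-> ->] := pair j s; rewrite ?xs ?orbT.
  - by rewrite eq_sym edge_sym.
  - by have [||||-> ->] := pair p q; rewrite ?xp.
  - by have [||||-> ->] := pair p s; rewrite ?xp.
  - by rewrite eq_sym edge_sym; have [||||-> ->] := pair 0 p; rewrite ?xp ?orbT.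
  - by have [||||-> ->] := pair q s; rewrite ?xq.
  - by rewrite eq_sym edge_sym; have [||||-> ->] := pair 0 q; rewrite ?xq ?orbT.
  - by rewrite eq_sym edge_sym; have [||||-> ->] := pair 0 s; rewrite ?xs ?orbT.
have [j2|j3] : j = 2 \/ j = 3 by clear -j1 m5'; lia.
  by apply: (prism 4 1 3); move: xj1 xjm x1 xm; rewrite m5' j2.
by apply: (prism 1 4 2); move: xj1 xjm x1 xm; rewrite m5' j3.
Qed.

Lemma fold_cycle5 m c : 5 <= m -> induced_copy m (cyclic_adj m) c ->
  (exists L d, [/\ 5 <= L <= m, induced_copy L (cyclic_adj L) d &
    forall k, k < L -> fold_image m c (d k)]) \/
  exists2 d, induced_copy 6 (cyclic_nonadj 6) d &
    forall k, k < 6 -> fold_image m c (d k).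
Proof.
move=> m5 cc; case: (fold_copy_or_mixed cc) => [ccphi|].
  left; exists m, (phi \o c); split=> //; first lia.
  by move=> k km; apply: fold_image_phi.
move=> [i [j [[im jm _ mix] bad]]].
have [j' j'm jj'] := rotate_onto im jm.
have i0 : rotate m i 0 = i by have := @rotateP m i 0; lia.
have := fold_cycle5_mixed0 m5 (induced_copy_rotate im cc) j'm.
rewrite /= i0 jj' => /(_ mix bad) [[L [d [Lm dc dF]]]|[d dc dF]].
  by left; exists L, d; split=> // k /dF; apply: fold_image_rotate.
by right; exists d => // k /dF; apply: fold_image_rotate.
Qed.

(** [x] takes the place of [c t]. All other vertices except the cyclic neighbours of [t] are in the
    link of [x], and these two share a side, so no mixed pair remains. *)
Lemma fold_anticycle_replace m c t : induced_copy m (cyclic_nonadj m) c ->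
  (forall k, k < m -> k != t ->
     if cyclic_adj m t k then ~~ star (c k) else edge x (c k)) ->
  (forall k l, k < m -> l < m -> k != t -> l != t ->
     cyclic_adj m t k -> cyclic_adj m t l -> side (c k) = side (c l)) ->
  exists L d, [/\ m <= L, induced_copy L (cyclic_nonadj L) d &
    forall k, k < L -> fold_image m c (d k)].
Proof.
move=> cc xt st; exists m, (phi \o (fun k => if k == t then x else c k)).
split=> // [k l km lm kl|k km] /=; last first.
  by case: eqP => _; [apply: fold_image_center|apply: fold_image_phi].
have xk k' : k' < m -> k' != t ->
    x != phi (c k') /\ edge x (phi (c k')) = cyclic_nonadj m t k'.
  move=> k'm k't; have := xt k' k'm k't; rewrite /cyclic_nonadj.
  by case: (cyclic_adj m t k') => [/fold_far|/fold_near].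
have [kt|kt] := eqVneq k t; have [lt|lt] := eqVneq l t.
- by move: kl; rewrite kt lt eqxx.
- by rewrite kt fold_center; apply: xk.
- by rewrite lt fold_center eq_sym edge_sym cyclic_nonadj_sym; apply: xk.
apply: (fold_pair cc) => //; rewrite /unmixed_for /in_star.
have := xt k km kt; case: ifP => [tk _|_ ->]; last by rewrite orbT.
have := xt l lm lt; case: ifP => [tl _|_ ->]; last by rewrite !orbT.
by rewrite (st k l) // eqxx !orbT.
Qed.

(** Vertices other than those at [m.-1], 0, 1, 2 are adjacent to both [c 0] and [c 1], which lie on
    different sides, so they belong to the link of [x]. The cases depend on [c 2] and [c m.-1]. *)
Lemma fold_anticycle_mixed0 m c :
  5 <= m -> induced_copy m (cyclic_nonadj m) c -> ~~ unmixed (c 0) (c 1) ->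
  phi (c 0) = phi (c 1) \/ edge (phi (c 0)) (phi (c 1)) ->
  exists L d, [/\ m <= L, induced_copy L (cyclic_nonadj L) d &
    forall k, k < L -> fold_image m c (d k)].
Proof.
move=> m5 cc mix bad; have [s0 s1 sd] := mixedP mix.
have [[m0 m1 m2 mm m3] [ne2m ne1m n02 n1m n2m]] := cyclic_small m5.
have adj i j : i < m -> j < m -> i != j -> ~~ cyclic_adj m i j ->
    edge (c i) (c j).
  by move=> im jm ij na; have [||| _ ->] := cc i j.
have side_eq i j : i < m -> j < m -> i != j -> ~~ cyclic_adj m i j ->
    ~~ star (c i) -> ~~ star (c j) -> side (c i) = side (c j).
  by move=> im jm ij na si sj; apply: (fold_side sf) => //; apply: adj.
have link j i : i < m -> j < m -> j != i -> ~~ cyclic_adj m j i ->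
    ~~ star (c j) -> star (c i) -> edge x (c i).
  move=> im jm ij na sj; rewrite /in_star => /orP[/eqP xi|//].
  by move: sj; rewrite /in_star negb_or -xi edge_sym (adj j i) // andbF.
have xmid k : 3 <= k < m.-1 -> edge x (c k).
  move=> /cyclic_mid[km ne0k ne1k n0k n1k].
  apply: (link 0) => //; apply: contraNT sd => sk.
  by rewrite (side_eq 0 k) // (side_eq 1 k).
have xk k : k < m -> edge x (c 2) || (k != 2) -> edge x (c m.-1) || (k != m.-1) ->
    k != 0 -> k != 1 -> edge x (c k).
  move=> km; have [->|k2] := eqVneq k 2; first by rewrite orbF.
  have [-> _|k' _ _ k0 k1] := eqVneq k m.-1; first by rewrite orbF.
  by apply/xmid/cyclic_midP.
(* Off the star, [c 2] is on the side of [c 0], and [x] can replace [c 1]. *)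
have [s2|s2] := boolP (star (c 2)); last first.
  have side2 := side_eq 0 2 m0 m2 isT n02 s0 s2.
  have xm : edge x (c m.-1).
    apply: (link 1) => //; apply: contraNT sd => sm.
    by rewrite side2 (side_eq 2 m.-1) // (side_eq 1 m.-1).
  apply: (fold_anticycle_replace (t := 1) cc) => [k km k1|k l km lm _ _].
    rewrite cyclic_adj1 //; case: ifPn => [/orP[]/eqP->//|].
    by rewrite negb_or => /andP[k0 k2]; apply: xk => //; rewrite ?xm ?k2 ?orbT.
  by rewrite !cyclic_adj1 // => /orP[]/eqP-> /orP[]/eqP->.
have x2 : edge x (c 2) by apply: (link 0).
(* Off the star, [c m.-1] is on the side of [c 1], and [x] can replace [c 0]. *)
have [sm|sm] := boolP (star (c m.-1)); last first.
  have sidem := side_eq 1 m.-1 m1 mm ne1m n1m s1 sm.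
  apply: (fold_anticycle_replace (t := 0) cc) => [k km k0|k l km lm _ _].
    rewrite cyclic_adj0 //; case: ifPn => [/orP[]/eqP->//|].
    by rewrite negb_or => /andP[k1 km']; apply: xk => //; rewrite ?x2 ?km' ?orbT.
  by rewrite !cyclic_adj0 // => /orP[]/eqP-> /orP[]/eqP->.
have xm : edge x (c m.-1) by apply: (link 1).
have {}xk k : k < m -> ~~ (k < 2) -> edge x (c k).
  by case: k => [|[|k]] // km _; apply: xk; rewrite ?x2 ?xm.
(* [c 2] is adjacent to [c 0] but not to [c 1], and the fold keeps this, so the images cannot
   coincide. *)
have e01 : edge (phi (c 0)) (phi (c 1)).
  case: bad => // eq01; have pair k : k < 2 ->
      edge (phi (c k)) (phi (c 2)) = cyclic_nonadj m k 2.
    move=> k2; have [||||//] := fold_pair cc (k := k) (l := 2);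
      rewrite ?(ltn_trans k2) //.
      by rewrite ltn_eqF.
    by rewrite /unmixed_for s2 orbT.
  have := pair 0 isT; rewrite eq01 pair // /cyclic_nonadj (negPf n02).
  by rewrite cyclic_adj1.
have neq01 : phi (c 0) != phi (c 1).
  by apply: contraTneq e01 => ->; rewrite edge_irr.
(* In the complement, the edge between 0 and 1 is lost and [x] subdivides it: the anticycle gains a
   vertex. *)
exists m.+1, (phi \o (fun k => if k == m then x else c (rotate m 1 k))).
split=> // [|k km] /=; last first.
  case: eqP => [_|km']; first exact: fold_image_center.
  apply/fold_image_phi/rotate_lt => //.
  by rewrite ltn_neqAle -ltnS km andbT; apply/eqP.
apply: induced_copy_lt => [|k l /andP[kl lm]]; first exact: cyclic_nonadj_sym.
have km : k < m by apply: leq_trans kl _.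
rewrite /= (ltn_eqF km); have [rm rk] := rotateP m1 km.
have [->|ln] := eqVneq l m.
  rewrite fold_center eq_sym edge_sym /cyclic_nonadj cyclic_adj_last //.
  have [far|near] := boolP (rotate m 1 k < 2).
    by case: (rotate m 1 k) far => [|[|]] // _; apply: fold_far.
  exact: fold_near (xk _ rm near).
have {ln}lm : l < m by rewrite ltn_neqAle ln.
have [sm' rl] := rotateP m1 lm.
have neq : rotate m 1 k != rotate m 1 l by apply: rotate_neq => //; rewrite ltn_eqF.
have [/andP[/eqP k0 /eqP lE]|kl'] := boolP ((k == 0) && (l == m.-1)).
  have -> : rotate m 1 k = 1 by clear -rk k0 m5 rm; lia.
  have -> : rotate m 1 l = 0 by clear -rl lE m5 sm'; lia.
  rewrite eq_sym neq01 edge_sym e01; split=> //.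
  by rewrite k0 lE /cyclic_nonadj cyclic_adj0; clear -m5; lia.
have [||||-> ->] := fold_pair cc (k := rotate m 1 k) (l := rotate m 1 l) => //.
  have : (1 < rotate m 1 k) || (1 < rotate m 1 l).
    by clear -rm rk sm' rl kl kl' m5 lm; lia.
  rewrite /unmixed_for /in_star.
  by case/orP=> h; [rewrite (xk _ rm)|rewrite (xk _ sm')];
    rewrite ?orbT // -leqNgt.
by rewrite /cyclic_nonadj cyclic_adj_extend ?kl.
Qed.

Lemma fold_anticycle m c : 5 <= m -> induced_copy m (cyclic_nonadj m) c ->
  exists L d, [/\ m <= L, induced_copy L (cyclic_nonadj L) d &
    forall k, k < L -> fold_image m c (d k)].
Proof.
move=> m5 cc; case: (fold_copy_or_mixed cc) => [ccphi|].
  by exists m, (phi \o c); split=> // k km; apply: fold_image_phi.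
have m1 : 1 < m by lia.
suff : forall i j, i < m -> j < m ->
    (j == i.+1) || ((j == 0) && (i.+1 == m)) ->
    ~~ unmixed (c i) (c j) ->
    phi (c i) = phi (c j) \/ edge (phi (c i)) (phi (c j)) ->
    exists L d, [/\ m <= L, induced_copy L (cyclic_nonadj L) d &
      forall k, k < L -> fold_image m c (d k)].
  move=> next [i [j [[im jm ij mix] bad]]]; have [si sj sd] := mixedP mix.
  have : cyclic_adj m i j.
    have [||| _ eij] := cc i j => //; apply: contraNT sd => nij.
    by rewrite (fold_side sf si sj) // eij.
  rewrite /cyclic_adj => adj.
  have [nij|nji] : (j == i.+1) || ((j == 0) && (i.+1 == m)) \/
    (i == j.+1) || ((i == 0) && (j.+1 == m)) by clear -adj; lia.
    exact: next nij mix bad.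
  apply: (next j i) => //; first by rewrite unmixedC.
  by case: bad => [->|]; [left|rewrite edge_sym; right].
move=> i j im jm ij mix bad.
have i0 : rotate m i 0 = i by have := @rotateP m i 0; lia.
have i1 : rotate m i 1 = j by have := rotateP im m1; lia.
have := fold_anticycle_mixed0 m5 (induced_copy_rotateN im cc).
rewrite /= i0 i1 => /(_ mix bad) [L [d [Lm dc dF]]].
by exists L, d; split=> // k /dF; apply: fold_image_rotate.
Qed.

End Fold.

(** * Folding the extension graph *)

Section ExtensionGraph.
Local Open Scope group_scope.
Local Open Scope classical_set_scope.
Variable G : sgraph.
Implicit Types (u v : G) (g h : raag G) (y z : extension_graph G).

Definition ext_vertex u g : extension_graph G :=
  exist _ (raag_gen u ^ g : commuting_graph (raag G))
    (mem_set (ex_intro _ u (ex_intro _ g erefl))).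

Definition ext_val y : raag G := val y.

Lemma ext_valE u g : ext_val (ext_vertex u g) = raag_gen u ^ g.
Proof. by []. Qed.

Lemma ext_val_inj : injective ext_val.
Proof. exact: val_inj. Qed.

Lemma ext_vertexP y : exists u g, y = ext_vertex u g.
Proof.
have [u [g yE]] := set_mem (valP y).
by exists u, g; apply: val_inj.
Qed.

Lemma ext_edgeE y z :
  edge y z = (y != z) && `[< commute (ext_val y) (ext_val z) >].
Proof. by []. Qed.

Lemma ext_starE y z : in_star y z = `[< commute (ext_val y) (ext_val z) >].
Proof.
rewrite /in_star ext_edgeE eq_sym; case: eqP => //= ->.
by rewrite asboolT //; apply: commute_refl.
Qed.

Lemma ext_vertex_comm u v g h :
  commute (ext_val (ext_vertex u g)) (ext_val (ext_vertex v h)) ->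
  in_star u v /\
  exists k, ext_vertex u g = ext_vertex u k /\ ext_vertex v h = ext_vertex v k.
Proof.
move=> /conj_comm[uv [k [uk vk]]]; split=> //; exists k.
by split; apply: ext_val_inj.
Qed.

Lemma ext_vertex_edge u v g h :
  edge (ext_vertex u g) (ext_vertex v h) -> edge u v.
Proof.
rewrite ext_edgeE => /andP[neq /asboolP /ext_vertex_comm[uv [k [uk vk]]]].
by case/orP: uv neq => [/eqP vu|//]; rewrite uk vk vu eqxx.
Qed.

Lemma ext_base : exists b : extension_graph G -> G,
  forall y z, edge y z -> edge (b y) (b z).
Proof.
have [b bP] := choice ext_vertexP.
exists b => y z; have [g yE] := bP y; have [h zE] := bP z.
by rewrite {1}yE {1}zE; apply: ext_vertex_edge.
Qed.

Lemma ext_vertex_eqE u v g : (ext_vertex u g == ext_vertex v g) = (u == v).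
Proof.
apply/eqP/eqP => [|-> //] /(congr1 ext_val); rewrite !ext_valE.
by case/conj_eq.
Qed.

Lemma ext_vertex_edgeE u v g :
  edge (ext_vertex u g) (ext_vertex v g) = edge u v.
Proof.
apply/idP/idP => [|uv]; first exact: ext_vertex_edge.
rewrite ext_edgeE ext_vertex_eqE; apply/andP; split.
  by apply: contraTneq uv => ->; rewrite edge_irr.
by apply/asboolP; rewrite !ext_valE /commute -!conjMg (raag_gen_comm uv).
Qed.

Lemma conj_vertex_subproof y g :
  [set z | exists u h, z = raag_gen u ^ h] (ext_val y ^ g).
Proof.
by have [u [h ->]] := ext_vertexP y; exists u, (h * g); rewrite ext_valE conjgM.
Qed.

Definition conj_vertex y g : extension_graph G :=
  exist _ (ext_val y ^ g : commuting_graph (raag G))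
    (mem_set (conj_vertex_subproof y g)).

Lemma conj_valE y g : ext_val (conj_vertex y g) = ext_val y ^ g.
Proof. by []. Qed.

Lemma conj_ext_vertex u h g : conj_vertex (ext_vertex u h) g = ext_vertex u (h * g).
Proof. by apply: ext_val_inj; rewrite conj_valE !ext_valE conjgM. Qed.

Lemma conj_vertex_eq y z g : (conj_vertex y g == conj_vertex z g) = (y == z).
Proof.
apply/eqP/eqP => [/(congr1 ext_val)|-> //]; rewrite !conj_valE.
by move/conjg_inj/ext_val_inj.
Qed.

Lemma conj_vertex_edge y z g : edge (conj_vertex y g) (conj_vertex z g) = edge y z.
Proof.
rewrite !ext_edgeE conj_vertex_eq; congr (_ && _).
by apply/asboolP/asboolP; rewrite !conj_valE /commute -!conjMg;
  [apply: conjg_inj|move->].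
Qed.

(** * Folding along one hyperplane *)

Section HyperplaneFold.
Variables (v : G) (h : raag G).

Local Notation center := (ext_vertex v h).
Local Notation x := (raag_gen v ^ h).

Definition ext_side y : bool :=
  `[< exists u g, y = ext_vertex u g /\ halfspace v (g * h^-1) >].

Definition ext_fold y := if ext_side y then conj_vertex y x^-1 else y.

(** The fold of the Cayley graph that acts on conjugators as [ext_fold] acts on vertices. *)
Definition group_fold g := if halfspace v (g * h^-1) then g * x^-1 else g.

Lemma halfspace_link g : in_span (edge v) g -> halfspace v g = false.
Proof.
case=> w Tw ->; apply/negP => hw; have := @halfspace_crossing _ (edge v) v w 1 Tw.
by rewrite mulg1 hw halfspace1 edge_irr => /(_ isT)[].
Qed.

(** At the lower end [g] of a dual edge, [g * h^-1] commutes with [v], so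
    [raag_gen v * g * x^-1 = g] and the edge collapses. *)
Lemma group_fold_link g : in_span (edge v) (g * h^-1) ->
  group_fold g = g /\ group_fold (raag_gen v * g) = g.
Proof.
move=> lg; have hg := halfspace_link lg; split; first by rewrite /group_fold hg.
rewrite /group_fold -mulgA -[raag_gen v]/(letter_val (v, true)).
rewrite halfspace_letter /crosses /= eqxx asboolT //= hg /letter_val /=.
have /in_span_comm cg : in_span (in_star v) (g * h^-1).
  by apply: in_spanS lg => u vu; rewrite /in_star vu orbT.
rewrite -conjVg conjgE !mulgA -[_ * g * _]mulgA cg mulgK mulgVK.
by [].
Qed.

Lemma group_fold_letter l g :
  group_fold (letter_val l * g) = letter_val l * group_fold g \/
  group_fold (letter_val l * g) = group_fold g.
Proof.
have [cr|cr] := boolP (crosses v l (g * h^-1)); [right|left]; last first.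
  rewrite /group_fold -mulgA halfspace_letter (negbTE cr) addFb.
  by case: ifP; rewrite ?mulgA.
case/andP: cr => /eqP lv /asboolP; case: l lv => [u b] /= ->.
case: b => [/group_fold_link[-> ->] //|].
rewrite mulgA => /group_fold_link[->].
by rewrite /letter_val /= mulVKg => ->.
Qed.

(** Conjugators of the vertex differ by the star group of [u]. A path in that group crossing the
    hyperplane would pass a conjugator common to the vertex and [center], with [v] in the star of
    [u], so the two would commute. *)
Lemma ext_sideE u g : ~~ in_star center (ext_vertex u g) ->
  ext_side (ext_vertex u g) = halfspace v (g * h^-1).
Proof.
rewrite ext_starE => /asboolPn nc.
apply/asboolP/idP => [[u' [g' [/(congr1 ext_val)]]]|hg]; last by exists u, g.
rewrite !ext_valE => /conj_eq[_ [s us ->]] hs; apply/negPn/negP => hg; case: nc.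
move: hs; rewrite -mulgA; have [w uw ->] := us => hs.
have := halfspace_crossing (v := v) (g := g * h^-1) uw.
rewrite hs (negbTE hg) => /(_ isT)[uv [w' [uw' _ lw]]].
have uw'g : in_span (in_star u) (word_val w') by exists w'.
rewrite !ext_valE -(conj_span g uw'g).
have lw' : in_span (in_star v) (word_val w' * (g * h^-1)).
  by apply: in_spanS lw => z vz; rewrite /in_star vz orbT.
have -> : word_val w' * g = (word_val w' * (g * h^-1)) * h.
  by rewrite -!mulgA mulVg mulg1.
rewrite -(conj_span h lw') /commute -!conjMg.
by congr (_ ^ _); apply/esym/in_star_comm.
Qed.

Lemma conj_vertex_star y : in_star center y -> conj_vertex y x^-1 = y.
Proof.
rewrite ext_starE => /asboolP c; apply: ext_val_inj; rewrite conj_valE conjgE invgK.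
by rewrite mulgA c mulgK.
Qed.

Lemma ext_fold_star y : in_star center y -> ext_fold y = y.
Proof. by move=> sy; rewrite /ext_fold conj_vertex_star //; case: ifP. Qed.

(** Both the identity and the conjugation fix the star, so one of them describes the fold on an
    unmixed pair. *)
Lemma ext_fold_cases y z : unmixed_for center ext_side y z ->
  ext_fold y = y /\ ext_fold z = z \/
  ext_fold y = conj_vertex y x^-1 /\ ext_fold z = conj_vertex z x^-1.
Proof.
rewrite /unmixed_for => /or3P[sy|sz|/eqP].
- by rewrite ext_fold_star // conj_vertex_star // /ext_fold; case: ifP; tauto.
- by rewrite (ext_fold_star sz) (conj_vertex_star sz) /ext_fold; case: ifP; tauto.
- by rewrite /ext_fold => ->; case: ifP; tauto.
Qed.

Lemma ext_star_fold : star_fold center ext_side ext_fold.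
Proof.
split=> [y|y z /ext_fold_cases|y z /ext_fold_cases|y z].
- exact: ext_fold_star.
- by case=> -[-> ->]; rewrite ?conj_vertex_edge.
- by case=> -[-> ->]; rewrite ?conj_vertex_eq.
have [u [g ->]] := ext_vertexP y; have [u' [g' ->]] := ext_vertexP z.
move=> sy sz; rewrite ext_edgeE => /andP[_ /asboolP].
(* Adjacent vertices share a conjugator [k], which decides both sides. *)
move=> /ext_vertex_comm[_ [k [yk zk]]]; move: sy sz; rewrite yk zk => sy sz.
by rewrite !ext_sideE.
Qed.

Lemma ext_fold_vertex u g : ext_fold (ext_vertex u g) = ext_vertex u (group_fold g).
Proof.
have [sy|sy] := boolP (in_star center (ext_vertex u g)).
  rewrite ext_fold_star // /group_fold; case: ifP => // _.
  by rewrite -conj_ext_vertex conj_vertex_star.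
rewrite /ext_fold /group_fold ext_sideE //.
by case: ifP; rewrite ?conj_ext_vertex.
Qed.

End HyperplaneFold.
End ExtensionGraph.

(** * Unfolding copies along Cayley walks *)

Section Unfolding.
Local Open Scope group_scope.
Local Open Scope classical_set_scope.
Variable G : sgraph.
Implicit Types (u v : G) (g h : raag G) (F : seq (raag G)).
Implicit Types y z : extension_graph G.

Definition carried F y := exists2 g, g \in F & exists u, y = ext_vertex u g.

(** Stationary steps are allowed so that a fold, which collapses some edges, keeps the length of a
    walk. *)
Definition cayley_step g h := h = g \/ exists l, h = letter_val l * g.

Fixpoint cayley_walk g F : Prop :=
  if F is h :: F' then cayley_step g h /\ cayley_walk h F' else True.

Lemma carriedS F F' y : {subset F <= F'} -> carried F y -> carried F' y.
Proof. by move=> sF [g gF yg]; exists g => //; apply: sF. Qed.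

Lemma cayley_walk_cat g F F' :
  cayley_walk g (F ++ F') <-> cayley_walk g F /\ cayley_walk (last g F) F'.
Proof. by elim: F g => [|h F IH] g /=; [|rewrite IH]; tauto. Qed.

Lemma cayley_walk_to g h : exists2 F, cayley_walk g F & last g F = h.
Proof.
have [w wE] := word_val_surj (h * g^-1); rewrite -[h](mulgVK g) {}wE.
elim: w => [|l w [F gF Fw]]; first by exists [::]; rewrite //= mul1g.
exists (rcons F (letter_val l * last g F)).
  rewrite -cats1; apply/cayley_walk_cat; split=> //=; split=> //.
  by right; exists l.
by rewrite last_rcons Fw word_val_cons mulgA.
Qed.

Lemma carried_walk (c : nat -> extension_graph G) m :
  exists2 F, cayley_walk 1 F & forall k, k < m -> carried (1 :: F) (c k).
Proof.
elim: m => [|m [F wF Fc]]; first by exists [::].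
have [u [g cm]] := ext_vertexP (c m).
have [F' wF' Fg] := cayley_walk_to (last 1 F) g.
exists (F ++ F'); first exact/cayley_walk_cat.
move=> k; rewrite ltnS leq_eqVlt => /orP[/eqP -> | /Fc].
  exists g; last by exists u.
  by rewrite -Fg -last_cat mem_last.
apply: carriedS => h.
by rewrite -cat_cons mem_cat => ->.
Qed.

Lemma cayley_walk_fold v h g F : cayley_walk g F ->
  cayley_walk (group_fold v h g) (map (group_fold v h) F).
Proof.
elim: F g => [//|k F IH] g /= [gk /IH wF]; split=> //.
case: gk => [-> | [l ->]]; first by left.
by case: (group_fold_letter v h l g) => ->; [right; exists l|left].
Qed.

Lemma carried_fold v h F y : carried F y ->
  carried (map (group_fold v h) F) (ext_fold v h y).
Proof.
move=> [g gF [u ->]]; exists (group_fold v h g); first exact: map_f.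
by exists u; apply: ext_fold_vertex.
Qed.

Lemma group_fold_base v h : group_fold v h h = h /\
  group_fold v h (raag_gen v * h) = h.
Proof. by apply: group_fold_link; rewrite mulgV; apply: in_span1. Qed.

(** [P] is a family of patterns, given by size and relation; a fold may exchange one member for
    another. *)
Definition closed_under_folds (E : sgraph) (P : nat -> rel nat -> Prop) :=
  forall (x : E) side phi, star_fold x side phi ->
  forall m r c, P m r -> induced_copy m r c ->
  exists m' r' d, [/\ P m' r', induced_copy m' r' d &
    forall k, k < m' -> fold_image x phi m c (d k)].

Lemma induced_copy_unfold P :
  closed_under_folds (extension_graph G) P ->
  forall m r (c : nat -> extension_graph G), P m r -> induced_copy m r c ->
  exists m' r' (d : nat -> G), P m' r' /\ induced_copy m' r' d.
Proof.
move=> closedP m r c Pm cc; have [F wF Fc] := carried_walk c m.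
move: {2}(size F) (erefl (size F)) (1 : raag G) wF m r c Pm cc Fc => n.
elim: n F => [|n IHn] [|g' F] //= szF g.
  move=> _ m r c Pm cc Fc.
  have /choice[d dP] : forall k, exists u, k < m -> c k = ext_vertex u g.
    move=> k; have [km|mk] := ltnP k m.
      have [h] := Fc k km; rewrite inE => /eqP -> [u cu].
      by exists u.
    (* From [m] on the value is arbitrary; [c k] merely supplies a vertex of [G]. *)
    by by have [u _] := ext_vertexP (c k); exists u.
  exists m, r, d; split=> // k l km lm kl.
  by have [] := cc k l km lm kl; rewrite !dP // ext_vertex_eqE ext_vertex_edgeE.
case: szF => szF; case=> [gg' wF] m r c Pm cc Fc.
(* [h] is the lower end of the first edge: [g] for a positive letter, [g'] for a negative one. *)
have [[v [h [hg hg']]]|eq] : (exists v h, group_fold v h g = h /\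
    group_fold v h g' = h) \/ g' = g.
- case: gg' => [|[[v b] ->]]; [by right|left; exists v].
  case: b; rewrite /letter_val /=; first by exists g; apply: group_fold_base.
  exists ((raag_gen v)^-1 * g).
  have [fh fvh] := group_fold_base v ((raag_gen v)^-1 * g).
  by split=> //; move: fvh; rewrite mulVKg.
- have [m' [r' [d [Pm' dc dF]]]] := closedP _ _ _ (ext_star_fold v h) m r c Pm cc.
  have wF' := cayley_walk_fold v h wF; rewrite hg' in wF'.
  apply: (IHn (map (group_fold v h) F) _ h wF' m' r' d) => //.
    by rewrite size_map.
  move=> k /dF[-> |[i im ->]].
    by exists h; [rewrite inE eqxx|exists v].
  apply: carriedS (carried_fold v h (Fc i im)) => z.
  by rewrite /= hg hg' !inE; case: (z == h).
rewrite eq in wF; apply: (IHn F szF g wF m r c) => // k /Fc.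
by apply: carriedS => z; rewrite eq !inE; case: (z == g).
Qed.

End Unfolding.

(** * Freeness in terms of numbered copies *)

Lemma graph_freeP (L E : sgraph) : graph_free L E <->
  ~ exists f : L -> E, injective f /\ {mono f : i j / edge i j}.
Proof.
split=> free; move=> [].
  move=> f [finj fmono]; apply: free; exists (range f).
  have fP (s : range f) : exists i, f i = val s.
    by have [i _ fi] := set_mem (valP s); exists i.
  have [g gP] := choice fP.
  exists g; split; last by move=> s t; rewrite /= -!gP fmono.
  have fr i : f i \in range f by apply/mem_set; exists i.
  exists (fun i => exist _ (f i) (fr i)) => [s|i].
    by apply: val_inj; rewrite /= gP.
  by apply: finj; rewrite gP.
move=> S [f [[g fK gK] fmono]]; apply: free; exists (val \o g); split.
  by move=> i j /val_inj /(can_inj gK).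
by move=> i j; rewrite -{2}[i]gK -{2}[j]gK fmono.
Qed.

Lemma graph_free_copyP m (e : rel 'I_m) (esym : symmetric e)
    (eirr : irreflexive e) (r : rel nat) (E : sgraph) :
  0 < m -> (forall i j : 'I_m, i != j -> e i j = r i j) ->
  graph_free (SGraph esym eirr) E <-> forall c : nat -> E, ~ induced_copy m r c.
Proof.
case: m e esym eirr => // m e esym eirr _ er; rewrite graph_freeP; split=> free.
  move=> c cc; apply: free; exists (fun i : 'I_m.+1 => c i); split.
    move=> i j cij; apply/eqP/negPn/negP => ij.
    by have [] := cc i j (ltn_ord i) (ltn_ord j) ij; rewrite cij eqxx.
  move=> i j; have [->|ij] := eqVneq i j; first by rewrite !edge_irr.
  by have [_ ->] := cc i j (ltn_ord i) (ltn_ord j) ij; rewrite /= er.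
case=> f [finj fmono]; apply: (free (f \o inord)) => i j im jm ij.
have ij' : inord i != inord j :> 'I_m.+1 by rewrite -val_eqE /= !inordK.
by rewrite /= (inj_eq finj) ij' fmono /= er // !inordK.
Qed.

Lemma cycle_edgeE m (i j : 'I_m) : i != j -> cycle_edge i j = cyclic_adj m i j.
Proof.
move=> ij; rewrite /cycle_edge ij /= -!val_eqE /=.
have ordSE (k : 'I_m) : k.+1 %% m = if k.+1 == m then 0 else k.+1.
  by case: eqP => [->|km]; rewrite ?modnn // modn_small //; have := ltn_ord k; lia.
rewrite !ordSE /cyclic_adj; have := ltn_ord i; have := ltn_ord j.
by case: ifP; case: ifP; lia.
Qed.

Lemma cycle_freeP m (E : sgraph) : 0 < m ->
  graph_free (cycle_graph m) E <->
  forall c : nat -> E, ~ induced_copy m (cyclic_adj m) c.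
Proof. by move=> m0; apply: graph_free_copyP => // i j; apply: cycle_edgeE. Qed.

Lemma anticycle_freeP m (E : sgraph) : 0 < m ->
  graph_free (compl_graph (cycle_graph m)) E <->
  forall c : nat -> E, ~ induced_copy m (cyclic_nonadj m) c.
Proof.
move=> m0; apply: graph_free_copyP => // i j ij.
by rewrite ij /= cycle_edgeE.
Qed.

(** * The properties of the extension graph *)

Lemma triangle_copy (E : sgraph) (c : nat -> E) :
  edge (c 0) (c 1) -> edge (c 0) (c 2) -> edge (c 1) (c 2) ->
  induced_copy 3 (cyclic_adj 3) c.
Proof.
move=> e01 e02 e12; apply: induced_copy_lt; first exact: cyclic_adj_sym.
suff : forall i j, i < j < 3 -> edge (c i) (c j).
  move=> h i j ij; have eij := h i j ij; rewrite eij; split.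
    by apply: contraTneq eij => ->; rewrite edge_irr.
  by rewrite /cyclic_adj; lia.
by move=> [|[|[|i]]] [|[|[|j]]] //=; rewrite ?andbF.
Qed.

Lemma triangle_free_extension (G : sgraph) :
  triangle_free G -> triangle_free (extension_graph G).
Proof.
rewrite /triangle_free !cycle_freeP // => free c cc.
have [b bP] := ext_base G; apply: (free (b \o c)).
by apply: triangle_copy; apply: bP;
  [have [|||_ ->] := cc 0 1|have [|||_ ->] := cc 0 2|have [|||_ ->] := cc 1 2].
Qed.

Lemma bipartite_extension (G : sgraph) :
  bipartite G -> bipartite (extension_graph G).
Proof.
move=> [c cP]; have [b bP] := ext_base G.
by exists (c \o b) => y z /bP /cP.
Qed.

(** Shortening can reach any length from 4 on, so the family is an interval. *)
Lemma closed_cycles4 (E : sgraph) n :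
  closed_under_folds E (fun m r => 4 <= m <= n /\ r = cyclic_adj m).
Proof.
move=> x side phi sf m _ c [/andP[m4 mn] ->] cc.
have [L [d [Lm dc dF]]] := fold_cycle4 sf m4 cc.
by exists L, (cyclic_adj L), d; split=> //; split=> //; lia.
Qed.

Lemma closed_cycles5 (E : sgraph) n : triangle_free E ->
  closed_under_folds E (fun m r => 5 <= m <= n /\ r = cyclic_adj m).
Proof.
move=> /cycle_freeP free x side phi sf m _ c [/andP[m5 mn] ->] cc.
have [[L [d [Lm dc dF]]]|[d dc _]] := fold_cycle5 sf m5 cc.
  by exists L, (cyclic_adj L), d; split=> //; split=> //; lia.
(* The vertices 0, 2, 4 of the complement of a hexagon span a triangle. *)
case: (free isT (d \o muln 2)); apply: triangle_copy.
- by have [|||_ ->] := dc 0 2.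
- by have [|||_ ->] := dc 0 4.
- by have [|||_ ->] := dc 2 4.
Qed.

(** A cycle may turn into an anticycle and an anticycle may grow, so the two families go together
    and have no upper bound. *)
Lemma closed_cycles_anticycles (E : sgraph) :
  closed_under_folds E
    (fun m r => 5 <= m /\ (r = cyclic_adj m \/ r = cyclic_nonadj m)).
Proof.
move=> x side phi sf m r c [m5 [->|->]] cc.
  have [[L [d [Lm dc dF]]]|[d dc dF]] := fold_cycle5 sf m5 cc.
    by exists L, (cyclic_adj L), d; split=> //; split; [lia|left].
  by exists 6, (cyclic_nonadj 6), d; split=> //; split=> //; right.
have [L [d [Lm dc dF]]] := fold_anticycle sf m5 cc.
by exists L, (cyclic_nonadj L), d; split=> //; split; [lia|right].
Qed.

Local Open Scope classical_set_scope.

Theorem lemma30 (G : sgraph) (finG : finite_set [set: G]) :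
  [/\ triangle_free G -> triangle_free (extension_graph G),
      square_free G -> square_free (extension_graph G),
      forall n : nat, 5 <= n ->
        triangle_free G \/ square_free G ->
        (forall m : nat, 5 <= m <= n -> graph_free (cycle_graph m) G) ->
        forall m : nat, 5 <= m <= n ->
          graph_free (cycle_graph m) (extension_graph G),
      weakly_chordal G -> weakly_chordal (extension_graph G) &
      bipartite G -> bipartite (extension_graph G)].
Proof.
split.
- exact: triangle_free_extension.
- rewrite /square_free !cycle_freeP // => free c cc.
  have [|m [r [d [[m4 ->] dc]]]] :=
    induced_copy_unfold (@closed_cycles4 _ 4) _ cc; first by [].
  have mE : m = 4 by lia.
  by apply: (free d); rewrite -mE.
- move=> n n5 tsfree cfree m m5n; apply/cycle_freeP => [|c cc]; first lia.
  (* Without triangles in the extension graph lengths stay at least 5; in the square-free case they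
     may drop to 4, which [G] excludes. *)
  case: tsfree => [/triangle_free_extension tfree|sfree].
    have [|m' [r [d [[m'5 ->] dc]]]] :=
      induced_copy_unfold (@closed_cycles5 _ n tfree) _ cc; first by [].
    by move: (cfree m' m'5); rewrite cycle_freeP; [move/(_ d)|lia].
  have [|m' [r [d [[m'4 ->] dc]]]] :=
    induced_copy_unfold (@closed_cycles4 _ n) _ cc; first by split=> //; lia.
  have [mE|m'5] : m' = 4 \/ 5 <= m' <= n by clear -m'4; lia.
    by move: sfree; rewrite /square_free cycle_freeP // => /(_ d); rewrite -mE.
  by move: (cfree m' m'5); rewrite cycle_freeP; [move/(_ d)|lia].
- move=> wc m m5; have m0 : 0 < m by lia.
  rewrite cycle_freeP // anticycle_freeP //.
  have noG m' r (d : nat -> G) :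
      5 <= m' /\ (r = cyclic_adj m' \/ r = cyclic_nonadj m') ->
      ~ induced_copy m' r d.
    case=> m'5 rE dc; have [] := wc m' m'5; have m'0 : 0 < m' by lia.
    rewrite cycle_freeP // anticycle_freeP // => /(_ d) nc /(_ d) nac.
    by case: rE dc => ->.
  split=> c cc; have [|m' [r [d [rE]]]] :=
    induced_copy_unfold (@closed_cycles_anticycles _) _ cc.
  + by split=> //; left.
  + exact: noG.
  + by split=> //; right.
  + exact: noG.
- exact: bipartite_extension.
Qed.
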